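(* Let $G$ and $H$ be directed graphs. Then there is a graph homomorphism from $G$ to $H$ if and only if there is a homomorphism of $2$-posets from $P_G$ to $P_H$.
   Context: A $k$-poset is an object $(P;\leq,c)$ where $(P;\leq)$ is a partially ordered set and $c\colon P\to\{0,1,\dots,k-1\}$ is a labeling function. A homomorphism of $k$-posets $h\colon(P;\leq,c)\to(P';\leq',c')$ is a map $h\colon P\to P'$ that preserves order ($x\leq y$ implies $h(x)\leq' h(y)$) and labels ($c=c'\circ h$). A directed graph is a pair $G=(V,E)$ with $E\subseteq V\times V$ (loops allowed; $V$ and $E$ are regarded as disjoint sets). A graph homomorphism $G\to H$ is a map $h\colon V(G)\to V(H)$ such that $(u,v)\in E(G)$ implies $(h(u),h(v))\in E(H)$. For a directed graph $G=(V,E)$, the $2$-poset $P_G=(P;\leq,c)$ is defined by $P=(V\cup E)\times\{0,1\}$, $c(a,b)=b$ for all $a\in V\cup E$, $b\in\{0,1\}$, and the covering relations of $\leq$ are exactly the following: $(a,0)<(a,1)$ for all $a\in V$; $(a,1)<(a,0)$ for all $a\in E$; and for each edge $(u,v)\in E$, $(u,0)<((u,v),0)$ and $((u,v),1)<(v,1)$. *)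

(* Defs.v *)
From Stdlib Require Import Relations.
From Stdlib Require Fin.

Set Implicit Arguments.
Unset Strict Implicit.

Record kposet (k : nat) := KPoset {
  carrier :> Type;
  le : relation carrier;
  le_order : order carrier le;
  label : carrier -> Fin.t k }.

Definition kposet_hom (k : nat) (P Q : kposet k) (h : P -> Q) : Prop :=
  (forall x y : P, le x y -> le (h x) (h y)) /\
  (forall x : P, label x = label (h x)).

Definition strict (T : Type) (r : relation T) : relation T :=
  fun x y => r x y /\ x <> y.

(* [covers r x y]: y covers x. *)
Definition covers (T : Type) (r : relation T) : relation T :=
  fun x y => strict r x y /\ ~ (exists z, strict r x z /\ strict r z y).

Record digraph := Digraph {
  vertex : Type;
  edge_rel : relation vertex }.

Definition graph_hom (G H : digraph) (h : vertex G -> vertex H) : Prop :=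
  forall u v : vertex G, edge_rel u v -> edge_rel (h u) (h v).

Definition edge (G : digraph) : Type :=
  {e : vertex G * vertex G | edge_rel (fst e) (snd e)}.

Definition src (G : digraph) (e : edge G) : vertex G := fst (proj1_sig e).
Definition tgt (G : digraph) (e : edge G) : vertex G := snd (proj1_sig e).

Definition zero2 : Fin.t 2 := Fin.F1.
Definition one2 : Fin.t 2 := Fin.FS Fin.F1.

(* The disjoint union of V and E is the sum type. *)
Definition PG_carrier (G : digraph) : Type :=
  ((vertex G + edge G) * Fin.t 2)%type.

Inductive PG_cover (G : digraph) : relation (PG_carrier G) :=
| PG_vertex (a : vertex G) : PG_cover (inl a, zero2) (inl a, one2)
| PG_edge (e : edge G) : PG_cover (inr e, one2) (inr e, zero2)
| PG_src (e : edge G) : PG_cover (inl (src e), zero2) (inr e, zero2)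
| PG_tgt (e : edge G) : PG_cover (inr e, one2) (inl (tgt e), one2).

(* [PG_coversP] below shows that the covering relation of this order is
   exactly [PG_cover]. *)
Definition PG_le (G : digraph) : relation (PG_carrier G) :=
  clos_refl_trans (PG_carrier G) (@PG_cover G).

(* The poset has height at most two. *)
Lemma PG_cover_cover (G : digraph) (x y z : PG_carrier G) :
  PG_cover x y -> PG_cover y z -> False.
Proof. intros Hxy Hyz; destruct Hxy; inversion Hyz. Qed.

Lemma PG_cover_neq (G : digraph) (x y : PG_carrier G) :
  PG_cover x y -> x <> y.
Proof.
intros Hxy E; apply (PG_cover_cover (x := x) (y := y) (z := y)); trivial.
now rewrite E in Hxy.
Qed.

Lemma PG_leE (G : digraph) (x y : PG_carrier G) :
  PG_le x y <-> x = y \/ PG_cover x y.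
Proof.
split.
- intros H; induction H as [x y H | x | x y z _ [Exy | Hxy] _ [Eyz | Hyz]];
    subst; auto.
  destruct (PG_cover_cover Hxy Hyz).
- intros [E | H]; [subst; apply rt_refl | now apply rt_step].
Qed.

Lemma PG_le_order (G : digraph) : order (PG_carrier G) (@PG_le G).
Proof.
split.
- intros x; apply rt_refl.
- intros x y z; apply rt_trans.
- intros x y Hxy Hyx; apply PG_leE in Hxy; apply PG_leE in Hyx.
  destruct Hxy as [E | Hxy]; trivial.
  destruct Hyx as [E | Hyx]; [now symmetry | destruct (PG_cover_cover Hxy Hyx)].
Qed.

Definition PG (G : digraph) : kposet 2 :=
  {| carrier := PG_carrier G;
     le := @PG_le G;
     le_order := PG_le_order G;
     label := fun x => snd x |}.

Lemma PG_coversP (G : digraph) (x y : PG G) :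
  covers (@le 2 (PG G)) x y <-> PG_cover x y.
Proof.
split.
- intros [[Hle Hne] _]; apply PG_leE in Hle; tauto.
- intros H; split.
  + split; [apply PG_leE; now right | now apply PG_cover_neq].
  + intros [z [[Hxz Nxz] [Hzy Nzy]]].
    apply PG_leE in Hxz; apply PG_leE in Hzy.
    destruct Hxz as [E | Hxz]; [now apply Nxz |].
    destruct Hzy as [E | Hzy]; [now apply Nzy |].
    exact (PG_cover_cover Hxz Hzy).
Qed.

(* Main.v *)
(* An order relation between differently labelled points of [PG H] rising from
   0 to 1 can only be the chain of a vertex, and one falling from 1 to 0 only
   the chain of an edge.  Hence a homomorphism of 2-posets sends vertices to
   vertices and edges to edges, consistently in both labels, and the two
   remaining kinds of covers say that it respects sources and targets. *)
Require Import Defs.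

Lemma PG_le_zero_one (G : digraph) (x y : PG G) :
  le x y -> label x = zero2 -> label y = one2 ->
  exists v : vertex G, x = (inl v, zero2) /\ y = (inl v, one2).
Proof.
intros Hxy Hx Hy; apply PG_leE in Hxy.
destruct Hxy as [E | Hxy].
- subst y; rewrite Hx in Hy; discriminate.
- destruct Hxy as [v | e | e | e]; try discriminate; now exists v.
Qed.

Lemma PG_le_one_zero (G : digraph) (x y : PG G) :
  le x y -> label x = one2 -> label y = zero2 ->
  exists e : edge G, x = (inr e, one2) /\ y = (inr e, zero2).
Proof.
intros Hxy Hx Hy; apply PG_leE in Hxy.
destruct Hxy as [E | Hxy].
- subst y; rewrite Hx in Hy; discriminate.
- destruct Hxy as [v | e | e | e]; try discriminate; now exists e.
Qed.

(** Distinct summands exclude equality, and the only cover from a vertex point to an edge point is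
    [PG_src]. *)
Lemma PG_le_src (G : digraph) (v : vertex G) (e : edge G) :
  @PG_le G (inl v, zero2) (inr e, zero2) -> v = src e.
Proof.
intros Hle; apply PG_leE in Hle; destruct Hle as [E | Hc]; [discriminate |].
now inversion Hc.
Qed.

Lemma PG_le_tgt (G : digraph) (v : vertex G) (e : edge G) :
  @PG_le G (inr e, one2) (inl v, one2) -> v = tgt e.
Proof.
intros Hle; apply PG_leE in Hle; destruct Hle as [E | Hc]; [discriminate |].
now inversion Hc.
Qed.

(** The endpoints are given explicitly, so [src] and [tgt] of the image reduce to [h (src e)] and
    [h (tgt e)], and [PG_map] sends covers to covers by conversion. *)
Definition edge_map {G H : digraph} {h : vertex G -> vertex H}
  (hh : graph_hom h) (e : edge G) : edge H :=
  exist _ (h (src e), h (tgt e)) (hh _ _ (proj2_sig e)).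

Definition PG_map {G H : digraph} {h : vertex G -> vertex H}
  (hh : graph_hom h) (x : PG G) : PG H :=
  (match fst x with
   | inl v => inl (h v)
   | inr e => inr (edge_map hh e)
   end, snd x).

Lemma PG_map_hom (G H : digraph) (h : vertex G -> vertex H)
  (hh : graph_hom h) : kposet_hom (PG_map hh).
Proof.
split; [| reflexivity].
intros x y Hxy; apply PG_leE in Hxy; apply PG_leE.
destruct Hxy as [E | Hc]; [left; now subst | right].
destruct Hc as [v | e | e | e].
- exact (PG_vertex (h v)).
- exact (PG_edge (edge_map hh e)).
- exact (PG_src (edge_map hh e)).
- exact (PG_tgt (edge_map hh e)).
Qed.

(* The [inr] branch is never taken when [h] is a homomorphism. *)
Definition vertex_map {G H : digraph} (h : PG G -> PG H) (v : vertex G) :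
  vertex H :=
  match fst (h (inl v, zero2)) with
  | inl w => w
  | inr e => src e
  end.

Section PosetHom.

Context {G H : digraph} {h : PG G -> PG H} (hh : kposet_hom h).

Lemma kposet_hom_cover (x y : PG G) : PG_cover x y -> le (h x) (h y).
Proof. intros Hc; apply (proj1 hh), PG_leE; now right. Qed.

(** [vertex_map] reads only the point labelled 0, but targets are compared at label 1; the chain of
    [v] links the two. *)
Lemma kposet_hom_vertex (v : vertex G) :
  h (inl v, zero2) = (inl (vertex_map h v), zero2) /\
  h (inl v, one2) = (inl (vertex_map h v), one2).
Proof.
destruct (PG_le_zero_one _ _ _ (kposet_hom_cover _ _ (PG_vertex v)))
  as [w [E0 E1]]; try (rewrite <- (proj2 hh); reflexivity).
unfold vertex_map; rewrite E0; auto.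
Qed.

(** A single [e'] for both labels ensures that the source found at label 0 and the target found at
    label 1 belong to the same edge. *)
Lemma kposet_hom_edge (e : edge G) :
  exists e' : edge H,
    h (inr e, zero2) = (inr e', zero2) /\ h (inr e, one2) = (inr e', one2).
Proof.
destruct (PG_le_one_zero _ _ _ (kposet_hom_cover _ _ (PG_edge e)))
  as [e' [E1 E0]]; try (rewrite <- (proj2 hh); reflexivity).
now exists e'.
Qed.

Lemma vertex_map_hom : graph_hom (vertex_map h).
Proof.
intros u v Huv.
pose (e := exist _ (u, v) Huv : edge G).
destruct (kposet_hom_edge e) as [e' [E0 E1]].
pose proof (kposet_hom_cover _ _ (PG_src e)) as Hs.
pose proof (kposet_hom_cover _ _ (PG_tgt e)) as Ht.
rewrite E0, (proj1 (kposet_hom_vertex _)) in Hs.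
rewrite E1, (proj2 (kposet_hom_vertex _)) in Ht.
apply PG_le_src in Hs; apply PG_le_tgt in Ht.
(* Up to conversion [u] and [v] are the endpoints of [e], whose images are now known to be those of
   [e']. *)
change (edge_rel (vertex_map h (src e)) (vertex_map h (tgt e))).
rewrite Hs, Ht; exact (proj2_sig e').
Qed.

End PosetHom.

Theorem proposition3p1 (G H : digraph) :
  (exists h : vertex G -> vertex H, graph_hom h) <->
  (exists h : PG G -> PG H, kposet_hom h).
Proof.
split; intros [h hh].
- exists (PG_map hh); apply PG_map_hom.
- exists (vertex_map h); exact (vertex_map_hom hh).
Qed.
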